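(* Let $X$, $(P_t)_{t\ge0}$, $\mathscr G$ and $\tau$ satisfy the standing assumptions (1)–(5) listed in the context. Let $X/\mathscr G=\{\tau(\mathscr G\times\{x\}):x\in X\}$ be the set of orbits of the action of $\mathscr G$, let $\pi:X\to X/\mathscr G$ be the canonical projection, and let $\pi_\#\mathscr B$ be the projected $\sigma$-algebra on $X/\mathscr G$, i.e. $E\in\pi_\#\mathscr B\iff\pi^{-1}(E)\in\mathscr B(X)$. Suppose that $P_t$ satisfies $\mathrm{(rAC)}_X$ with $r(u_0)=\infty$ for every $u_0\in X$. Then any two Radon probability measures $\mu,\nu$ on $X$ which are invariant with respect to $P_t$ satisfy $$\mu\perp\nu\iff\pi_\#\mu\perp\pi_\#\nu,$$ and similarly $$\mu\ll\nu\iff\pi_\#\mu\ll\pi_\#\nu.$$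
   Context: Standing assumptions. (1) $X$ is a metric space with distance $d_X$, $\mathscr B(X)$ its Borel $\sigma$-algebra, and $\mathscr L^\infty(X)$ is the space of bounded Borel functions $X\to\mathbb R$ with the sup norm $\|\cdot\|_\infty$. (2) $(P_t)_{t\ge0}$ is a Markov semigroup on $\mathscr L^\infty(X)$: each $P_t$ is linear and bounded on $\mathscr L^\infty(X)$, $P_{t+s}=P_tP_s=P_sP_t$, $f\ge0$ implies $P_tf\ge0$, and $P_t\mathbb 1=\mathbb 1$. (3) $\mathscr G$ is a topological group with identity $e$, with a function $|\cdot|:\mathscr G\to\mathbb R$ such that $|g|\ge0$ with equality iff $g=e$, $|g^{-1}|=|g|$, $|g_1g_2|\le|g_1|+|g_2|$; the topology of $\mathscr G$ is induced by the distance $d_{\mathscr G}(g_1,g_2)=|g_1^{-1}g_2|$. $B_r=\{g\in\mathscr G:|g|\le r\}$ (with $B_\infty=\mathscr G$). (4) $\tau:\mathscr G\times X\to X$, $\tau_g(x)=\tau(g,x)$, is a group action: $\tau_e(x)=x$ and $\tau_{g_1g_2}(x)=\tau_{g_1}(\tau_{g_2}(x))$. (5) For every compact $K\subseteq X$, $\lim_{r\to0}\sup_{x\in K}\sup_{g\in B_r}d_X(x,\tau_g(x))=0$, and for every $r\ge0$ and compact $K\subseteq X$, $\tau(B_r\times K)\in\mathscr B(X)$. Induced distance. On $X$, $d_{\mathscr G}(u_1,u_2)=\inf\{|g|:g\in\mathscr G,\ u_1=\tau_g(u_2)\}\in[0,\infty]$ (with $\inf\emptyset=\infty$). For $\varphi:X\to\mathbb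 R$, $\|\varphi\|_{\mathscr G\text{-Lip}}=\sup_{u_1\ne u_2}\frac{|\varphi(u_1)-\varphi(u_2)|}{d_{\mathscr G}(u_1,u_2)}$. $\mathrm{(rAC)}_S$ (asymptotic coupling property restricted to the action of $\mathscr G$ on $S\subseteq X$): there exist times $t_n\ge0$ and positive reals $\delta_n\to0$ such that for every $u_0\in S$ there is $r=r(u_0)\in(0,\infty]$ such that for every $g\in B_{r(u_0)}$ and every $\varphi\in\mathscr L^\infty(X)$ with $\|\varphi\|_{\mathscr G\text{-Lip}}<\infty$, $$|P_{t_n}\varphi(u_0)-P_{t_n}\varphi(\tau_g(u_0))|\le2\varepsilon_0(u_0,g)\|\varphi\|_\infty+\delta_nC(u_0,g)\|\varphi\|_{\mathscr G\text{-Lip}},$$ where $\varepsilon_0(u_0,g)<1$ and $C(u_0,g)<\infty$ for every $u_0\in S$, $g\in B_{r(u_0)}$. A Borel probability measure $\mu$ on $X$ is invariant for $P_t$ if $\int_XP_t\varphi\,d\mu=\int_X\varphi\,d\mu$ for all $\varphi\in\mathscr L^\infty(X)$, $t\ge0$. $\pi_\#\mu(E)=\mu(\pi^{-1}(E))$ for $E\in\pi_\#\mathscr B$; Radon, Borel and compact refer to the topology of $d_X$. *)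

(* Defs.v *)
From HB Require Import structures.
From mathcomp Require Import all_boot all_order all_algebra.
From mathcomp Require Import all_classical all_reals all_analysis.

Set Implicit Arguments.
Unset Strict Implicit.
Unset Printing Implicit Defensive.

Import Order.TTheory GRing.Theory Num.Theory.
Import numFieldNormedType.Exports.

Local Open Scope classical_set_scope.
Local Open Scope ring_scope.

(* [measurableType] asks for a point, hence so do the metric spaces used here.
   Only the empty space is excluded, and it carries no probability measure. *)
#[short(type="pMetricType")]
HB.structure Definition PointedMetric (R : numDomainType) :=
  {X of Pointed X & Metric R X}.

HB.mixin Record isTopologicalGroup G & Group G & Topological G := {
  mulg_continuous : continuous (fun x : G * G => (x.1 * x.2)%g) ;
  invg_continuous : continuous (fun x : G => (x^-1)%g) }.

#[short(type="topologicalGroupType")]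
HB.structure Definition TopologicalGroup :=
  {G of Group G & Topological G & isTopologicalGroup G}.

Notation borel X := (g_sigma_algebraType (@open X)).

Section bounded_borel_functions.
Context {R : realType} {X : pMetricType R}.

Definition Linfty (f : X -> R) : Prop :=
  measurable_fun [set: borel X] (f : borel X -> R) /\ bounded_fun f.

Definition sup_norm (f : X -> R) : R := sup [set `|f x| | x in [set: X]].

(* Times range over [0, +oo[ and functions over [Linfty]; the values of
   [P t f] outside these domains are irrelevant. *)
Record markov_semigroup (P : R -> (X -> R) -> X -> R) : Prop := {
  markov_Linfty : forall t f, 0 <= t -> Linfty f -> Linfty (P t f) ;
  markov_linear : forall t a f g, 0 <= t -> Linfty f -> Linfty g ->
    P t (fun x => a * f x + g x) = (fun x => a * P t f x + P t g x) ;
  markov_bounded : forall t, 0 <= t ->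
    exists M : R, forall f, Linfty f -> sup_norm (P t f) <= M * sup_norm f ;
  markov_add : forall t s f, 0 <= t -> 0 <= s -> Linfty f ->
    P (t + s) f = P t (P s f) /\ P (t + s) f = P s (P t f) ;
  markov_ge0 : forall t f, 0 <= t -> Linfty f ->
    (forall x, 0 <= f x) -> forall x, 0 <= P t f x ;
  markov_cst1 : forall t, 0 <= t -> P t (fun=> 1) = (fun=> 1) }.

Definition invariant_measure (P : R -> (X -> R) -> X -> R)
    (mu : probability (borel X) R) : Prop :=
  forall f t, Linfty f -> 0 <= t ->
    (\int[mu]_(x in [set: borel X]) (P t f x)%:E =
     \int[mu]_(x in [set: borel X]) (f x)%:E)%E.

(* For a finite Borel measure on a metric space, being Radon amounts to inner
   regularity with respect to compact sets. *)
Definition radon (mu : probability (borel X) R) : Prop :=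
  forall A : set (borel X), measurable A ->
    mu A = ereal_sup [set mu K | K in [set K : set X | compact K /\ K `<=` A]].

End bounded_borel_functions.

Definition mutually_singular d (T : measurableType d) (R : realType)
    (mu nu : set T -> \bar R) : Prop :=
  exists N : set T, [/\ measurable N, mu N = 0%E & nu (~` N) = 0%E].

Section group_action.
Context {R : realType} {X : pMetricType R} {G : topologicalGroupType}.
Implicit Types (len : G -> R) (tau : G -> X -> X).

(* The last field says that the topology of [G] is the one induced by the
   distance (g, h) |-> len (g^-1 * h). *)
Record group_norm len : Prop := {
  len_ge0 : forall g, 0 <= len g ;
  len_eq0 : forall g, len g = 0 <-> g = 1%g ;
  lenV : forall g, len (g^-1)%g = len g ;
  lenM : forall g h, len (g * h)%g <= len g + len h ;
  len_nbhs : forall g : G, nbhs g =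
    filter_from [set r : R | 0 < r] (fun r => [set h | len (g^-1 * h)%g < r]) }.

Definition gball len (r : \bar R) : set G := [set g | ((len g)%:E <= r)%E].

Record group_action tau : Prop := {
  act1 : forall x, tau 1%g x = x ;
  actM : forall g h x, tau (g * h)%g x = tau g (tau h x) }.

(* [K] is nonempty because [ereal_sup set0 = -oo], whereas the supremum of an
   empty set of distances has to be read as 0. *)
Definition action_unif_continuous len tau : Prop :=
  forall K : set X, compact K -> K !=set0 ->
    (fun r : R => ereal_sup
      [set ereal_sup [set (mdist x (tau g x))%:E | g in gball len r%:E]
      | x in K]) @ 0^'+ --> 0%E.

Definition action_measurable len tau : Prop :=
  forall (r : R) (K : set X), 0 <= r -> compact K ->
    measurable ([set tau g x | g in gball len r%:E & x in K] : set (borel X)).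

Definition gdist len tau (u1 u2 : X) : \bar R :=
  ereal_inf [set (len g)%:E | g in [set g | u1 = tau g u2]].

(* The supremum is taken in [0, +oo], so it is 0 on a one-point space. The
   division is that of [\bar R], with x / +oo = 0. *)
Definition glip len tau (phi : X -> R) : \bar R :=
  Order.max 0%E (ereal_sup
    [set (`|phi u.1 - phi u.2|%:E / gdist len tau u.1 u.2)%E
    | u in [set u : X * X | u.1 != u.2]]).

(* Asymptotic coupling restricted to the action of [G] on [S], with radius
   [r u0] at each [u0] in [S]. *)
Definition rAC (P : R -> (X -> R) -> X -> R) len tau (S : set X)
    (r : X -> \bar R) : Prop :=
  exists (t delta : nat -> R) (eps0 C : X -> G -> R),
    [/\ forall n, 0 <= t n,
        forall n, 0 < delta n,
        delta @ \oo --> 0 &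
        forall u0, S u0 -> (0 < r u0)%E /\
          forall g, gball len (r u0) g ->
            eps0 u0 g < 1 /\
            forall phi, Linfty phi -> (glip len tau phi < +oo)%E ->
              forall n,
                (`|P (t n) phi u0 - P (t n) phi (tau g u0)|%:E <=
                 (2 * eps0 u0 g * sup_norm phi)%:E +
                 (delta n * C u0 g)%:E * glip len tau phi)%E].

Definition act_orbit tau (x : X) : set X := [set tau g x | g in [set: G]].

Definition orbit_space tau : Type :=
  set_type [set act_orbit tau x | x in [set: X]].

Definition orbit_proj tau (x : borel X) : orbit_space tau :=
  SigSub (mem_set (ex_intro2 _ _ x I erefl)).

End group_action.

Definition orbit_display : measure_display -> measure_display.
Proof. exact. Qed.

Section orbit_measurable.
Context (R : realType) (X : pMetricType R) (G : topologicalGroupType).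
Variable tau : G -> X -> X.

Let orbit_measurable : set (set (orbit_space tau)) :=
  [set E | measurable (orbit_proj tau @^-1` E)].

Let orbit_measurable0 : orbit_measurable set0.
Proof. by rewrite /orbit_measurable /= preimage_set0. Qed.

Let orbit_measurableC A : orbit_measurable A -> orbit_measurable (~` A).
Proof. by rewrite /orbit_measurable /= preimage_setC; exact: measurableC. Qed.

Let orbit_measurable_bigcup (F : (set (orbit_space tau))^nat) :
  (forall i, orbit_measurable (F i)) -> orbit_measurable (\bigcup_i F i).
Proof.
rewrite /orbit_measurable /= preimage_bigcup => mF.
exact: bigcupT_measurable.
Qed.

HB.instance Definition _ := Choice.on (orbit_space tau).
HB.instance Definition _ :=
  isPointed.Build (orbit_space tau) (orbit_proj tau point).
HB.instance Definition _ :=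
  @isMeasurable.Build (orbit_display (@open X).-sigma) (orbit_space tau)
    orbit_measurable orbit_measurable0 orbit_measurableC
    orbit_measurable_bigcup.

End orbit_measurable.

(* Main.v *)
Require Import Defs.
From mathcomp Require Import all_boot all_order all_algebra.
From mathcomp Require Import all_classical all_reals all_analysis.
From mathcomp Require Import measurable_realfun lra.

Set Implicit Arguments.
Unset Strict Implicit.
Unset Printing Implicit Defensive.

Import Order.TTheory GRing.Theory Num.Theory.
Import numFieldNormedType.Exports.

Local Open Scope classical_set_scope.
Local Open Scope ring_scope.

(** Two implications are immediate, since every event of the orbit space pulls
    back to a saturated Borel set. The other two follow from a single statement
    about a Borel [nu]-null set [N] that is maximal in the sense that [mu] restricted
    to the complement of [N] is absolutely continuous with respect to [nu]:
    [mu]-almost all of [N] is covered by a saturated Borel set [E] which is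
    still [nu]-null ([saturated_null_cover]). If [mu] and [nu] are singular,
    [N] is any [nu]-null set that carries [mu]. If [mu] is not absolutely
    continuous, [N] comes from an exhaustion ([maximal_null_set]), has positive
    [mu]-measure, and the image of [E] in the orbit space is null for the
    projection of [nu] but not for that of [mu].

    The set [E] is built from cutoffs [D j = min 1 (l j * dist x (K j))], where
    the compact sets [K j] fill [N] and the distance is the one induced by the
    action of [G]. They are Lipschitz for this distance, they vanish on [K j],
    and by the continuity of the action at compact sets they increase to [1]
    off [K j] as [l j] grows ([cutoff_cvg1]), so that [1 - D j] can be given an
    arbitrarily small [nu]-integral, summable in [j]. Choose the indices [n j]
    of the times [s j = t (n j)] so large that the Lipschitz term
    [delta (n j) * l j] of the coupling estimate tends to [0]. Invariance of [nu] makes [P (s j) (D j)] converge to [1] [nu]-almost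
    everywhere. Invariance of both measures and maximality of [N] make it
    converge to [0] [mu]-almost everywhere on [N] ([markov_integral_on]). Two
    points [a] and [tau g a] cannot have the limits [0] and [1], because the
    coupling estimate bounds the oscillation by [eps0 a g < 1] in the limit.
    Hence the orbits of almost all points of [N] lie in a [nu]-null set. Such a
    union of orbits may fail to be Borel, but the union of the orbits of a
    [K_sigma] subset of full measure is Borel, because [tau] sends products of
    balls and compact sets to Borel sets. *)

(** * Null sets and almost everywhere convergence *)

Section measure_lemmas.
Context d (T : measurableType d) (R : realType).
Implicit Types mu nu : {measure set T -> \bar R}.

(** The series of the [g j] has a finite integral, hence is finite almost
    everywhere, and the terms of a convergent series tend to [0]. *)
Lemma summable_integral_cvg0 mu (D : set T) (g : nat -> T -> R) :
  measurable D -> (forall j, measurable_fun D (g j)) ->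
  (forall j x, 0 <= g j x) ->
  (\sum_(j <oo) \int[mu]_(x in D) (g j x)%:E < +oo)%E ->
  exists N, [/\ measurable N, mu N = 0%E &
    forall x, D x -> ~ N x -> g ^~ x @ \oo --> 0].
Proof.
move=> mD mg g0 ig.
pose h j := EFin \o g j; have h0 j x : (0 <= h j x)%E by rewrite lee_fin.
have mh j : measurable_fun D (h j) by exact/measurable_EFinP.
pose S x := (\sum_(0 <= j <oo) h j x)%E.
have mS : measurable_fun D S.
  by apply: (ge0_emeasurable_sum (h := h) (P := xpredT)).
have S0 x : (0 <= S x)%E by exact: nneseries_ge0.
have iS : mu.-integrable D S.
  apply/integrableP; split => //.
  under eq_integral do rewrite gee0_abs//.
  by rewrite integral_nneseries.
have [N [mN N0 SN]] := integrable_ae mD iS.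
exists N; split => // x Dx Nx.
have Sx : (S x < +oo)%E.
  rewrite -ge0_fin_numE//; apply: contrapT => Sx.
  by apply: Nx; apply: SN => /(_ Dx).
have tl : (\sum_(n <= k <oo) h k x @[n --> \oo] --> 0)%E.
  exact: (nneseries_tail_cvg Sx).
suff : h ^~ x @ \oo --> 0%E by move/fine_cvg.
apply: squeeze_cvge (cvg_cst _) tl.
apply: nearW => n /=; rewrite h0/=.
by have := @nneseries_lim_ge R (h ^~ x) xpredT n n.+1; rewrite big_nat1; exact.
Qed.

(** The null set [N] is obtained by exhaustion: its [mu]-measure is the
    largest among [nu]-null sets, so a [nu]-null set that exceeded it by a
    [mu]-positive set could be adjoined to [N]. *)
Lemma maximal_null_set (mu : {finite_measure set T -> \bar R}) nu :
  exists N, [/\ measurable N, nu N = 0%E &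
    forall A, measurable A -> nu A = 0%E -> mu (A `\` N) = 0%E].
Proof.
pose F := [set mu A | A in [set A | measurable A /\ nu A = 0%E]].
have supF : ereal_sup F \is a fin_num.
  rewrite ge0_fin_numE; last first.
    by apply: ereal_sup_ubound; exists set0; rewrite ?measure0.
  apply: (@le_lt_trans _ _ (mu setT)).
    by apply: ge_ereal_sup => _ [A [mA _] <-]; apply: le_measure; rewrite ?inE.
  by rewrite -ge0_fin_numE// fin_num_measure.
have /choice[A HA] : forall n : nat, exists A,
    [/\ measurable A, nu A = 0%E & (ereal_sup F - (n.+1%:R^-1)%:E < mu A)%E].
  move=> n; have n0 : 0 < n.+1%:R^-1 :> R by rewrite invr_gt0.
  have [_ [A [mA nA] <-] lA] := ub_ereal_sup_adherent n0 supF.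
  by exists A.
have mA n : measurable (A n) by have [] := HA n.
pose N := \bigcup_n A n.
have mN : measurable N by exact: bigcupT_measurable.
have nN : nu N = 0%E.
  apply/eqP; rewrite eq_le measure_ge0 andbT.
  apply: le_trans (measure_sigma_subadditive _ mA mN (@subset_refl _ _)) _.
  by rewrite eseries0// => n _ _; have [] := HA n.
exists N; split => // B mB nB.
have muN : (ereal_sup F <= mu N)%E.
  apply/lee_addgt0Pr => e e0.
  have [n _ /(_ n (leqnn n)) /= ne] := near_infty_natSinv_lt (PosNum e0).
  have [_ _] := HA n; rewrite lteBlDr// => /ltW/le_trans; apply.
  apply: leeD; last by rewrite lee_fin ltW.
  by apply: le_measure; rewrite ?inE//; exact: bigcup_sup.
have mBN : measurable (B `\` N) by exact: measurableD.
have : (mu (N `|` B `\` N) <= mu N)%E.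
  apply: le_trans muN; apply: ereal_sup_ubound.
  exists (N `|` B `\` N) => //; split; first exact: measurableU.
  apply/eqP; rewrite eq_le measure_ge0 andbT.
  apply: le_trans (measureU2 _ mN mBN) _.
  rewrite -[X in (_ <= X)%E]adde0 -{1}nN leeD// -nB.
  by apply: le_measure; rewrite ?inE//; exact: subDsetl.
rewrite measureU//; last by rewrite setDIK.
rewrite -[X in (_ <= X)%E]adde0 leeD2lE ?fin_num_measure// => h.
by apply/eqP; rewrite eq_le h measure_ge0.
Qed.

End measure_lemmas.

(** * Lipschitz cutoffs of compact sets *)

Section borel_sets.
Context (R : realType) (X : pMetricType R).
Implicit Types (K : set X) (mu : probability (borel X) R).

Lemma borel_compact K : compact K -> measurable (K : set (borel X)).
Proof.
move=> /(compact_closed (@metric_hausdorff R X)) cK.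
rewrite -(setCK K); apply: measurableC; apply: sub_sigma_algebra.
exact: closed_openC.
Qed.

Lemma radon_inner mu (A : set (borel X)) (e : R) :
  radon mu -> measurable A -> 0 < e ->
  exists K : set X, [/\ compact K, K `<=` A & (mu (A `\` K) <= e%:E)%E].
Proof.
move=> rmu mA e0.
have fA : ereal_sup [set mu K | K in [set K : set X | compact K /\ K `<=` A]]
    \is a fin_num by rewrite -rmu// fin_num_measure.
have [_ [K [cK KA] <-]] := ub_ereal_sup_adherent e0 fA.
rewrite -rmu// => ltK; exists K; split => //.
have mK := borel_compact cK.
have fK : mu K \is a fin_num by rewrite fin_num_measure.
rewrite measureD ?(setIidr KA)//; last first.
  by rewrite -ge0_fin_numE// fin_num_measure.
rewrite leeBlDl//.
by rewrite lteBlDl in ltK => //; rewrite addeC ltW.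
Qed.

End borel_sets.

Section cutoff.
Context (R : realType) (X : pMetricType R) (G : topologicalGroupType).
Variables (len : G -> R) (tau : G -> X -> X).
Implicit Types (K : set X) (x : X) (l : R).

Definition cutoff_values K l x : set R :=
  [set 1] `|` [set l * len g | g in [set g | exists2 k, K k & tau g k = x]].

(** This is [min 1 (l * dist x K)] for the extended distance [gdist], which
    is infinite between distinct orbits. The value [1] keeps the set of values
    nonempty when [x] lies on no orbit through [K]. *)
Definition cutoff K l x : R := inf (cutoff_values K l x).

Hypotheses (len_norm : group_norm len) (tau_action : group_action tau).

Lemma cutoff_values_neq0 K l x : cutoff_values K l x !=set0.
Proof. by exists 1; left. Qed.

Lemma cutoff_values_lbound K l x : 0 <= l -> lbound (cutoff_values K l x) 0.
Proof.
by move=> l0 _ [->//|[g _ <-]]; rewrite mulr_ge0// (len_ge0 len_norm).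
Qed.

Lemma cutoff_ge0 K l x : 0 <= l -> 0 <= cutoff K l x.
Proof.
move=> l0; apply: lb_le_inf; first exact: cutoff_values_neq0.
exact: cutoff_values_lbound.
Qed.

Lemma cutoff_le1 K l x : 0 <= l -> cutoff K l x <= 1.
Proof.
by move=> l0; apply: ge_inf; [exists 0; exact: cutoff_values_lbound|left].
Qed.

Lemma cutoff_le_len K l g k : 0 <= l -> K k ->
  cutoff K l (tau g k) <= l * len g.
Proof.
move=> l0 Kk; apply: ge_inf; first by exists 0; exact: cutoff_values_lbound.
by right; exists g => //; exists k.
Qed.

Lemma cutoff_eq0 K l x : 0 <= l -> K x -> cutoff K l x = 0.
Proof.
move=> l0 Kx; apply/eqP; rewrite eq_le cutoff_ge0// andbT.
rewrite -[in cutoff K l x](act1 tau_action x).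
apply: le_trans (cutoff_le_len _ l0 Kx) _.
by rewrite (proj2 (len_eq0 len_norm 1%g) erefl) mulr0.
Qed.

Lemma cutoff_act K l h x : 0 <= l ->
  cutoff K l (tau h x) <= cutoff K l x + l * len h.
Proof.
move=> l0; rewrite -lerBlDr; apply: lb_le_inf; first exact: cutoff_values_neq0.
move=> _ [->|[g [k Kk <-] <-]]; rewrite lerBlDr.
  rewrite (le_trans (cutoff_le1 _ _ l0))// lerDl.
  by rewrite mulr_ge0// (len_ge0 len_norm).
rewrite -(actM tau_action) (le_trans (cutoff_le_len _ l0 Kk))//.
by rewrite -mulrDr ler_wpM2l// addrC (lenM len_norm).
Qed.

Lemma cutoff_lipschitz K l g x : 0 <= l ->
  `|cutoff K l (tau g x) - cutoff K l x| <= l * len g.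
Proof.
move=> l0; rewrite ler_distl; apply/andP; split; last exact: cutoff_act.
have := cutoff_act K (g^-1)%g (tau g x) l0.
rewrite -(actM tau_action) mulVg (act1 tau_action) (lenV len_norm).
by rewrite lerBlDr.
Qed.

Lemma cutoff_ltP K l x c : 0 < l -> c <= 1 -> cutoff K l x < c <->
  exists2 g, l * len g < c & exists2 k, K k & tau g k = x.
Proof.
move=> l0 c1; split=> [lt_c|[g gc [k Kk <-]]]; last first.
  exact: le_lt_trans (cutoff_le_len _ (ltW l0) Kk) gc.
have [y + yc] := inf_lt (cutoff_values_neq0 K l x) lt_c.
case=> [y1|[g Kg gy]]; last by exists g => //; rewrite gy.
by move: yc; rewrite y1 ltNge c1.
Qed.

Hypothesis tau_measurable : action_measurable len tau.

(** The strict sublevel sets of the cutoff are countable unions of the sets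
    [tau (B_r * K)], which are Borel by assumption. *)
Lemma measurable_cutoff K l : compact K -> 0 < l ->
  measurable_fun [set: borel X] (cutoff K l : borel X -> R).
Proof.
move=> cK l0.
apply: (measurability _ (RGenInftyO.measurableE R)) => _ [_ [c ->] <-].
rewrite setTI; have [c1|c1] := leP c 1; last first.
  rewrite (_ : _ @^-1` _ = setT)// -subTset => x _ /=.
  by rewrite in_itv/= (le_lt_trans (cutoff_le1 _ _ (ltW l0))).
(* Closed balls of radius [r n] increase to the open ball of radius [c / l]. *)
pose r n : R := c / l - n.+1%:R^-1.
rewrite (_ : _ @^-1` _ =
  \bigcup_n [set tau g x | g in gball len (r n)%:E & x in K]).
  apply: bigcupT_measurable => n; have [r0|r0] := leP 0 (r n).
    exact: tau_measurable.
  rewrite (_ : [set _ | _ in _ & _ in _] = set0) ?measurable0//.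
  rewrite -subset0 => x [g]; rewrite /gball/= lee_fin => gr _.
  by have := lt_le_trans r0 (le_trans (len_ge0 len_norm g) gr); rewrite ltxx.
apply/seteqP; split => x /=; rewrite in_itv/=.
  move/(cutoff_ltP _ _ l0 c1) => [g].
  rewrite mulrC -ltr_pdivlMr// -subr_gt0 => gc [k Kk <-].
  have [n _ /(_ n (leqnn n)) /= nc] := near_infty_natSinv_lt (PosNum gc).
  exists n => //; exists g; last by exists k.
  by rewrite /gball/= lee_fin /r lerBrDr -lerBrDl ltW.
move=> [n _ [g + [k Kk <-]]]; rewrite /gball/= lee_fin => gr.
apply/(cutoff_ltP _ _ l0 c1); exists g; last by exists k.
rewrite mulrC -ltr_pdivlMr// (le_lt_trans gr)// ltrBlDr ltrDl invr_gt0.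
by rewrite ltr0n.
Qed.

Lemma Linfty_cutoff K l : compact K -> 0 < l -> Linfty (cutoff K l).
Proof.
move=> cK l0; split; first exact: measurable_cutoff.
exists 1; split => // y y1 x _ /=.
by rewrite ger0_norm ?cutoff_ge0 ?ltW// (le_lt_trans (cutoff_le1 _ _ (ltW l0))).
Qed.

Lemma glip_cutoff K l c : 0 < l ->
  (glip len tau (fun x => cutoff K l x + c)%R <= l%:E)%E.
Proof.
move=> l0; rewrite /glip ge_max lee_fin ltW//=.
apply: ge_ereal_sup => _ [[u1 u2] /= _ <-].
rewrite opprD addrACA subrr addr0.
set a := `|_|; set d := gdist _ _ _ _.
have ad : ((a / l)%:E <= d)%E.
  apply: le_ereal_inf_tmp => _ [g /= ug <-].
  by rewrite lee_fin ler_pdivrMr// mulrC /a ug; apply: cutoff_lipschitz; exact: ltW.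
have a0 : 0 <= a by exact: normr_ge0.
have al0 : 0 <= a / l by rewrite divr_ge0// ltW.
(* The supremum defining [glip] also involves pairs with [d = 0] or
   [d = +oo], for which [d^-1] is [+oo] or [0]. *)
clearbody a d; move: ad; case: d => [r| |//]; last first.
  by move=> _; rewrite invey mule0 lee_fin ltW.
rewrite lee_fin => ar; rewrite inver; case: eqVneq => [r0|r0].
  have -> : a = 0.
    apply/eqP; rewrite eq_le a0 andbT.
    by move: ar; rewrite r0 ler_pdivrMr// mul0r.
  by rewrite mul0e lee_fin ltW.
have {}r0 : 0 < r by rewrite lt_neqAle eq_sym r0 (le_trans al0).
by rewrite lee_pdivrMr// -EFinM lee_fin mulrC -ler_pdivrMr.
Qed.

Hypothesis tau_continuous : action_unif_continuous len tau.

(** A point off [K] stays at positive [gdist] from [K], because short group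
    elements displace the points of [K] by less than the metric distance from
    [x] to [K], which is positive as [K] is closed. *)
Lemma cutoff_cvg1 K x : compact K -> ~ K x ->
  (fun m : nat => cutoff K m.+1%:R x) @ \oo --> (1 : R).
Proof.
move=> cK Kx.
have [s s0 Hs] : exists2 s : R, 0 < s &
    forall g k, K k -> tau g k = x -> s <= len g.
  have [K0|K0] := pselect (K !=set0); last first.
    by exists 1 => // g k Kk _; exfalso; apply: K0; exists k.
  have cldK : closed K := compact_closed (@metric_hausdorff R X) cK.
  have [e /= e0 Ke] : nbhs_ball x (~` K).
    by apply/nbhs_ballP; apply: open_nbhs_nbhs; split => //; exact: closed_openC.
  have Ne : nbhs (0%E : \bar R) [set y | (y < e%:E)%E].
    by apply: open_ereal_lt'; rewrite lte_fin.
  have He := tau_continuous cK K0 Ne.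
  have [r [r0 re]] := filter_ex (filterI (nbhs_right_gt 0) He).
  exists r => // g k Kk gkx; rewrite leNgt; apply/negP => gr.
  apply: (Ke k) => //; rewrite ballEmdist/= metric_sym -lte_fin.
  apply: le_lt_trans re; rewrite -gkx.
  apply: le_trans (ereal_sup_ubound _); last by exists k.
  by apply: ereal_sup_ubound; exists g => //; rewrite /gball/= lee_fin ltW.
apply: cvg_near_cst; near=> m.
apply/eqP; rewrite eq_le cutoff_le1//=.
apply: lb_le_inf; first exact: cutoff_values_neq0.
move=> _ [->//|[g [k Kk gkx] <-]].
rewrite (le_trans _ (ler_wpM2l _ (Hs _ _ Kk gkx)))//.
rewrite -ler_pdivrMl// mulr1 ltW//.
by near: m; exact: (near_infty_natSinv_lt (PosNum s0)).
Unshelve. all: by end_near. Qed.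

End cutoff.

(** * Markov operators and invariant measures *)

Section markov.
Context (R : realType) (X : pMetricType R).
Implicit Types (f g : X -> R) (mu nu : probability (borel X) R).

Lemma Linfty_cst (c : R) : Linfty (fun _ : X => c).
Proof.
split; first exact: measurable_cst.
by exists `|c|; split => // y cy x _ /=; exact: ltW.
Qed.

Lemma Linfty_indic (K : set (borel X)) : measurable K -> Linfty (\1_K : X -> R).
Proof.
move=> mK; split; first exact: measurable_indic.
exists 1; split => // y y1 x _ /=; rewrite indicE.
by case: (_ \in _) => /=; rewrite ?normr1 ?normr0 ltW// (lt_trans ltr01).
Qed.

Lemma LinftyD f g : Linfty f -> Linfty g -> Linfty (fun x => f x + g x).
Proof.
move=> [mf bf] [mg bg]; split; first exact: measurable_funD.
exact: (@bounded_funD X R f g).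
Qed.

Lemma LinftyB1 f : Linfty f -> Linfty (fun x => 1 - f x).
Proof.
move=> [mf bf]; apply: (@LinftyD (cst 1) (fun x => - f x)).
  exact: Linfty_cst.
by split; [exact: measurable_funN|exact: (@bounded_funN X R f)].
Qed.

Variable P : R -> (X -> R) -> X -> R.
Hypothesis P_markov : markov_semigroup P.

Lemma markovDc t f c : 0 <= t -> Linfty f ->
  P t (fun x => f x + c) = (fun x => P t f x + c).
Proof.
move=> t0 Lf.
have := markov_linear P_markov c t0 (Linfty_cst 1) Lf.
rewrite (markov_cst1 P_markov)// => Pfc.
rewrite (_ : (fun x => f x + c) = (fun x => c * 1 + f x)) ?Pfc.
  by apply/funext => x; rewrite mulr1 addrC.
by apply/funext => x; rewrite mulr1 addrC.
Qed.

Lemma markov1B t f : 0 <= t -> Linfty f ->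
  P t (fun x => 1 - f x) = (fun x => 1 - P t f x).
Proof.
move=> t0 Lf.
have := markov_linear P_markov (-1) t0 Lf (Linfty_cst 1).
rewrite (markov_cst1 P_markov)// => Pf.
rewrite (_ : (fun x => 1 - f x) = (fun x => -1 * f x + 1)) ?Pf.
  by apply/funext => x; rewrite mulN1r addrC.
by apply/funext => x; rewrite mulN1r addrC.
Qed.

Lemma markov_le t f g : 0 <= t -> Linfty f -> Linfty g ->
  (forall x, f x <= g x) -> forall x, P t f x <= P t g x.
Proof.
move=> t0 Lf Lg fg x; rewrite -subr_ge0 addrC -mulN1r.
have <- := congr1 (@^~ x) (markov_linear P_markov (-1) t0 Lf Lg).
apply: (markov_ge0 P_markov) => // [|y]; last by rewrite mulN1r addrC subr_ge0.
split; first by apply: measurable_funD Lg.1; apply: measurable_funM Lf.1.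
apply: (@bounded_funD X R (fun x => -1 * f x) g) Lg.2.
rewrite (_ : (fun _ => _) = (fun x => - f x)); last first.
  by apply/funext => y; rewrite mulN1r.
exact: (@bounded_funN X R f Lf.2).
Qed.

(** Although [P] need not act on measures, it cannot move [nu]-null mass out
    of [N]: [P t \1_K] vanishes [nu]-a.e. by invariance of [nu], hence
    [mu]-a.e. outside [N], so all the mass [mu K] of its [mu]-integral lies in
    [N]. The bound follows from [f <= 1 - \1_K]. *)
Lemma markov_integral_on mu nu (N K : set (borel X)) t f :
  invariant_measure P mu -> invariant_measure P nu ->
  measurable N -> measurable K -> K `<=` N -> nu N = 0%E ->
  (forall A, measurable A -> nu A = 0%E -> mu (A `\` N) = 0%E) ->
  0 <= t -> Linfty f -> (forall x, 0 <= f x <= 1) -> (forall x, K x -> f x = 0) ->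
  (\int[mu]_(x in N) (P t f x)%:E <= mu (N `\` K))%E.
Proof.
move=> imu inu mN mK KN nuN munu t0 Lf f01 fK.
have L1K := Linfty_indic mK.
pose h := P t \1_K.
have Lh : Linfty h by exact: (markov_Linfty P_markov).
have h0 x : 0 <= h x by apply: (markov_ge0 P_markov) => // y; rewrite indicE.
have mh : measurable_fun [set: borel X] (EFin \o (h : borel X -> R)).
  by apply/measurable_EFinP; exact: Lh.1.
have inth (m : probability (borel X) R) : invariant_measure P m ->
    (\int[m]_(x in setT) (h x)%:E = m K)%E.
  by move=> im; rewrite im// integral_indic// setIT.
have nuK : nu K = 0%E.
  by apply/eqP; rewrite -measure_le0 -nuN le_measure ?inE.
have [Z [mZ nuZ hZ]] : ae_eq nu setT (EFin \o h) (cst 0%E).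
  apply/ae_eq_integral_abs => //.
  by under eq_integral do rewrite gee0_abs ?lee_fin//=; rewrite inth.
have hNc : (\int[mu]_(x in ~` N) (h x)%:E = 0)%E.
  under eq_integral do rewrite -[(_)%:E]gee0_abs ?lee_fin//.
  have mhN : measurable_fun (~` N) (EFin \o (h : borel X -> R)).
    exact: measurable_funTS.
  apply: (proj2 (ae_eq_integral_abs mu (measurableC mN) mhN)).
  exists (Z `\` N); split; [exact: measurableD|exact: munu|].
  move=> x /= /not_implyP[Nx hx]; split => //; apply: hZ => /= /(_ I).
  exact: hx.
have hN : (\int[mu]_(x in N) (h x)%:E = mu K)%E.
  have NNc : [disjoint N & ~` N] by apply/disj_setPS; rewrite setICr.
  have mNc : measurable (~` N) by exact: measurableC.
  have hU : measurable_fun (N `|` ~` N) (EFin \o (h : borel X -> R)).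
    exact: measurable_funTS.
  rewrite -inth// -(setUv N) (ge0_integral_setU mu mN mNc hU)//=.
    by rewrite hNc adde0.
  by move=> x _; rewrite lee_fin.
have fKN x : f x <= 1 - \1_K x.
  rewrite indicE; case: (asboolP (K x)) => Kx.
    by rewrite mem_set// fK// subrr.
  by rewrite memNset// subr0; case/andP: (f01 x).
have Lf' := markov_Linfty P_markov t0 Lf.
have Pf0 x : 0 <= P t f x.
  by apply: (markov_ge0 P_markov) => // y; case/andP: (f01 y).
have Pfh x : P t f x + h x <= 1.
  rewrite -lerBrDr; have /= <- := congr1 (@^~ x) (markov1B t0 L1K).
  by apply: markov_le => //; exact: LinftyB1.
have fK' : mu K \is a fin_num by rewrite fin_num_measure.
have -> : mu (N `\` K) = (mu N - mu K)%E.
  by rewrite measureD ?(setIidr KN)// -ge0_fin_numE// fin_num_measure.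
rewrite leeBrDr// -hN -ge0_integralD//=; last 4 first.
- by move=> x _; rewrite lee_fin.
- by apply: measurable_funTS; apply/measurable_EFinP; exact: Lf'.1.
- by move=> x _; rewrite lee_fin.
- exact: measurable_funTS.
rewrite -[leRHS]mul1e -integral_cst//.
apply: ge0_le_integral => //.
- by move=> x _; rewrite -EFinD lee_fin addr_ge0.
- apply: measurable_funTS; apply/measurable_EFinP.
  by apply: measurable_funD; [exact: Lf'.1|exact: Lh.1].
- by move=> x _; rewrite -EFinD lee_fin.
Qed.

End markov.

(** * Coupling along orbits *)

Section coupling.
Context (R : realType) (X : pMetricType R) (G : topologicalGroupType).
Variables (P : R -> (X -> R) -> X -> R) (len : G -> R) (tau : G -> X -> X).
Hypotheses (P_markov : markov_semigroup P) (len_norm : group_norm len)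
  (tau_action : group_action tau) (tau_continuous : action_unif_continuous len tau)
  (tau_measurable : action_measurable len tau).
Implicit Types (mu nu : probability (borel X) R) (K : set X).

Let Lcutoff K l := @Linfty_cutoff R X G len tau len_norm tau_measurable K l.

(** [rAC] is applied to [cutoff - 1/2], whose sup norm is at most [1/2]: it is
    this centring that turns the factor [2 * eps0] into [eps0]. *)
Lemma rAC_cutoff (t delta eps0 C : R) K l x g :
  compact K -> 0 < l -> 0 <= t -> 0 < delta ->
  (forall phi, Linfty phi -> (glip len tau phi < +oo)%E ->
     (`|P t phi x - P t phi (tau g x)|%:E <=
      (2 * eps0 * sup_norm phi)%:E + (delta * C)%:E * glip len tau phi)%E) ->
  `|P t (cutoff len tau K l) x - P t (cutoff len tau K l) (tau g x)| <=
    Num.max eps0 0 + delta * l * `|C|.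
Proof.
move=> cK l0 t0 d0 Hrac; set D := cutoff len tau K l.
pose phi x := D x + - 2^-1.
have LD : Linfty D by exact: Lcutoff.
have Lphi : Linfty phi by exact: (LinftyD LD (Linfty_cst X (- 2^-1))).
have gl : (glip len tau phi <= l%:E)%E by exact: glip_cutoff.
have gl0 : (0 <= glip len tau phi)%E by rewrite /glip le_max lexx.
have := Hrac phi Lphi (le_lt_trans gl (ltry _)).
rewrite (markovDc P_markov)// opprD addrACA subrr addr0 => Hphi.
have phi2 y : `|phi y| <= 2^-1.
  have D0 : 0 <= D y by rewrite cutoff_ge0 ?ltW.
  have D1 : D y <= 1 by rewrite cutoff_le1 ?ltW.
  by rewrite ler_norml /phi; apply/andP; split; lra.
have sphi : sup_norm phi <= 2^-1.
  by apply: ge_sup => [|_ [y _ <-]//]; exists `|phi point|, point.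
have sphi0 : 0 <= sup_norm phi.
  apply: le_trans (normr_ge0 (phi point)) _; apply: ub_le_sup.
    by exists 2^-1 => _ [y _ <-].
  by exists point.
rewrite -lee_fin; apply: le_trans Hphi _; rewrite EFinD leeD//.
  by rewrite lee_fin; have [e0|e0] := leP 0 eps0; nra.
apply: (@le_trans _ _ ((delta * `|C|)%:E * glip len tau phi)%E).
  by apply: lee_wpmul2r => //; rewrite lee_fin ler_wpM2l ?ler_norm// ltW.
rewrite (_ : delta * l * `|C| = delta * `|C| * l); last by rewrite mulrAC.
by rewrite (EFinM _ l); apply: lee_wpmul2l => //; rewrite lee_fin mulr_ge0// ltW.
Qed.

(** Since [nu] does not charge [K], the integrals of [1 - cutoff K l] tend to
    [0] as [l] grows. *)
Lemma cutoff_integral_small mu nu (N : set (borel X)) (e : R) :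
  radon mu -> measurable N -> nu N = 0%E -> 0 < e ->
  exists Kl : set X * R, [/\ compact Kl.1, Kl.1 `<=` N, 0 < Kl.2,
    (mu (N `\` Kl.1) <= e%:E)%E &
    (\int[nu]_(x in setT) (1 - cutoff len tau Kl.1 Kl.2 x)%:E <= e%:E)%E].
Proof.
move=> rmu mN nuN e0.
have [K [cK KN muK]] := radon_inner rmu mN e0.
have mK := borel_compact cK.
pose f m x : \bar R := (1 - cutoff len tau K m.+1%:R x)%:E.
have mf m : measurable_fun [set: borel X] (f m : borel X -> \bar R).
  by apply/measurable_EFinP; apply: (LinftyB1 _).1; exact: Lcutoff.
have f01 m x : (0 <= f m x <= 1)%E.
  rewrite !lee_fin subr_ge0 gerBl.
  by rewrite (cutoff_le1 _ len_norm)// (cutoff_ge0 _ len_norm).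
have nuK : nu K = 0%E.
  by apply/eqP; rewrite -measure_le0 -nuN le_measure ?inE.
have f0 : {ae nu, forall x, [set: borel X] x -> f ^~ x @ \oo --> 0%E}.
  exists K; split => // x /= /not_implyP[_ fx].
  apply: contrapT => Kx; apply: fx; apply/cvg_EFin; first exact: nearW.
  rewrite -[X in _ --> X](subrr 1).
  apply: cvgB; first exact: cvg_cst.
  exact: (cutoff_cvg1 len_norm tau_continuous cK Kx).
have f1 : {ae nu, forall x n, [set: borel X] x -> (`|f n x| <= cst 1%E x)%E}.
  by apply: aeW => x n _; case/andP: (f01 n x) => f0x fx1; rewrite gee0_abs.
have [_ _] := dominated_convergence measurableT mf (measurable_cst _) f0
  (finite_measure_integrable_cst nu 1 measurableT) f1.
rewrite integral0 => cvf.
have Ne : nbhs (0%E : \bar R) [set y | (y < e%:E)%E].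
  by apply: open_ereal_lt'; rewrite lte_fin.
have [m _ /(_ m (leqnn m)) /= fm] := cvf _ Ne.
by exists (K, m.+1%:R) => //=; split => //; exact: ltW.
Qed.

(** With cutoffs [D j] of compact sets filling [N], [f j := P (t (n j)) (D j)]
    tends to [0] on [N `\` Z1], which is [mu]-almost all of [N], and to [1] off
    the [nu]-null set [Z2]. The coupling property keeps the upper limit of
    [`|f j a - f j (tau g a)|] below [1], so the orbits of the points of
    [N `\` Z1] stay in [Z2]; [E] is the union of the orbits of countably many
    compact subsets that exhaust [N `\` Z1]. *)
Lemma saturated_null_cover mu nu (N : set (borel X)) :
  rAC P len tau [set: X] (fun=> +oo%E) ->
  radon mu -> invariant_measure P mu -> invariant_measure P nu ->
  measurable N -> nu N = 0%E ->
  (forall A, measurable A -> nu A = 0%E -> mu (A `\` N) = 0%E) ->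
  exists E : set (borel X), [/\ measurable E, forall g x, E x -> E (tau g x),
    nu E = 0%E & mu (N `\` E) = 0%E].
Proof.
move=> [t [delta [eps0 [C [t0 d0 d_cvg0 Hrac]]]]] rmu imu inu mN nuN munu.
pose e j : R := 1 / (2 ^ j.+1)%:R.
have e0 j : 0 < e j by rewrite divr_gt0// ltr0n expn_gt0.
have sum_e (a : nat -> \bar R) : (forall j, 0 <= a j)%E ->
    (forall j, a j <= (e j)%:E)%E -> (\sum_(j <oo) a j < +oo)%E.
  move=> a0 ae; apply: (@le_lt_trans _ _ 1%:E); last by rewrite ltry.
  apply: le_trans (epsilon_trick0 xpredT ler01).
  by apply: lee_nneseries => j *; [exact: a0|exact: ae].
have /choice[Kl HKl] := fun j => cutoff_integral_small rmu mN nuN (e0 j).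
pose K j := (Kl j).1; pose l j := (Kl j).2.
have cK j : compact (K j) by case: (HKl j).
have KN j : K j `<=` N by case: (HKl j).
have l0 j : 0 < l j by case: (HKl j).
have mK j := borel_compact (cK j).
have /choice[n dl] : forall j : nat, exists n, delta n * l j <= j.+1%:R^-1.
  move=> j.
  have jl0 : 0 < j.+1%:R^-1 / l j by rewrite divr_gt0// invr_gt0 ltr0n.
  have [n _ /(_ n (leqnn n)) /=] := (cvgrPdist_lt _ _).1 d_cvg0 _ jl0.
  rewrite sub0r normrN gtr0_norm// => /ltW dn; exists n.
  by rewrite -ler_pdivlMr.
pose D j := cutoff len tau (K j) (l j).
have LD j : Linfty (D j) by exact: Lcutoff.
have D01 j x : 0 <= D j x <= 1.
  by rewrite (cutoff_ge0 _ len_norm) ?(cutoff_le1 _ len_norm)// ltW.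
pose f j := P (t (n j)) (D j).
have Lf j : Linfty (f j) by exact: (markov_Linfty P_markov).
have f0 j x : 0 <= f j x.
  by apply: (markov_ge0 P_markov) => // y; case/andP: (D01 j y).
have f1E j x : 1 - f j x = P (t (n j)) (fun y => 1 - D j y) x.
  by rewrite (markov1B P_markov).
have f1 j x : 0 <= 1 - f j x.
  rewrite f1E; apply: (markov_ge0 P_markov) => // [|y]; first exact: LinftyB1.
  by rewrite subr_ge0; case/andP: (D01 j y).
have [Z1 [mZ1 muZ1 fcvg0]] : exists Z, [/\ measurable Z, mu Z = 0%E &
    forall x, N x -> ~ Z x -> f ^~ x @ \oo --> 0].
  apply: summable_integral_cvg0 => // [j|].
    by apply: measurable_funTS; exact: (Lf j).1.
  apply: sum_e => j; first by apply: integral_ge0 => x _; rewrite lee_fin.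
  have [_ _ _ muK _] := HKl j; apply: le_trans muK.
  apply: (markov_integral_on P_markov imu inu mN (mK j) (KN j) nuN munu
    (t0 (n j)) (LD j) (D01 j)) => x Kx.
  by rewrite /D (cutoff_eq0 len_norm tau_action)// ltW.
have [Z2 [mZ2 nuZ2 fcvg1]] : exists Z, [/\ measurable Z, nu Z = 0%E &
    forall x, setT x -> ~ Z x -> (fun j => 1 - f j x) @ \oo --> 0].
  apply: summable_integral_cvg0 => // [j|].
    exact: (LinftyB1 (Lf j)).1.
  apply: sum_e => j; first by apply: integral_ge0 => x _; rewrite lee_fin.
  under eq_integral do rewrite f1E.
  rewrite inu//; last exact: LinftyB1.
  by have [_ _ _ _ nuK] := HKl j.
have orbit_Z2 a g : N a -> ~ Z1 a -> Z2 (tau g a).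
  move=> Na Za; apply: contrapT => Zga.
  have [_ /(_ g)[]] := Hrac a I; first by rewrite /gball/= leey.
  set ep := Num.max (eps0 a g) 0.
  move=> eps1 Hphi.
  have ep1 : ep < 1 by rewrite gt_max eps1 ltr01.
  (* By the triangle inequality [1 <= u j], while [u] tends to [ep < 1]. *)
  pose u j : R := f j a + (1 - f j (tau g a)) + (ep + j.+1%:R^-1 * `|C a g|).
  have ucvg : u @ \oo --> 0 + 0 + (ep + 0 * `|C a g|).
    apply: cvgD; first by apply: cvgD; [exact: fcvg0|exact: fcvg1].
    apply: cvgD; first exact: cvg_cst.
    by apply: cvgMl; exact: cvg_harmonic.
  suff : 1 <= ep by rewrite leNgt ep1.
  have -> : ep = lim (u @ \oo).
    by rewrite (cvg_lim (@Rhausdorff R) ucvg) mul0r !add0r addr0.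
  apply: limr_ge; first by apply/cvg_ex; eexists; exact: ucvg.
  apply: nearW => j; rewrite /u.
  have fag := rAC_cutoff (cK j) (l0 j) (t0 (n j)) (d0 (n j))
    (fun phi Lphi gphi => Hphi phi Lphi gphi (n j)).
  have {}fag : `|f j a - f j (tau g a)| <= ep + j.+1%:R^-1 * `|C a g|.
    by apply: le_trans fag _; rewrite lerD2l ler_wpM2r.
  rewrite distrC in fag; move: (le_trans (ler_norm _) fag).
  by move: (f j a) (f j _) (ep + _) => p q w; lra.
have mA : measurable (N `\` Z1) by exact: measurableD.
have /choice[L HL] : forall j : nat, exists L : set X,
    [/\ compact L, L `<=` N `\` Z1 &
      (mu ((N `\` Z1) `\` L) <= (j.+1%:R^-1)%:E)%E].
  by move=> j; apply: radon_inner => //; rewrite invr_gt0 ltr0n.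
have cL j : compact (L j) by case: (HL j).
pose E : set (borel X) := \bigcup_j \bigcup_m
  [set tau g x | g in gball len (m%:R)%:E & x in L j].
have mE : measurable E.
  apply: bigcupT_measurable => j; apply: bigcupT_measurable => m.
  exact: tau_measurable.
have EP g x j : L j x -> E (tau g x).
  move=> Lx; exists j => //; exists (Num.bound (len g)) => //.
  exists g; last by exists x.
  by rewrite /gball/= lee_fin ltW// archi_boundP// (len_ge0 len_norm).
exists E; split => //.
- move=> g _ [j _ [m _ [h _ [x Lx <-]]]].
  by rewrite -(actM tau_action); exact: EP Lx.
- apply/eqP; rewrite -measure_le0 -nuZ2 le_measure ?inE//.
  move=> _ [j _ [m _ [h _ [x Lx <-]]]].
  by have [_ /(_ x Lx)[Nx Zx] _] := HL j; exact: orbit_Z2.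
- apply/eqP; rewrite -measure_le0; apply/lee_addgt0Pr => r r0.
  rewrite add0e.
  have [j _ /(_ j (leqnn j)) /= jr] := near_infty_natSinv_lt (PosNum r0).
  have [_ _ muL] := HL j; have mL := borel_compact (cL j).
  have mAL : measurable ((N `\` Z1) `\` L j) by exact: measurableD.
  apply: (@le_trans _ _ (mu (Z1 `|` ((N `\` Z1) `\` L j)))).
    apply: le_measure; rewrite ?inE//.
    + exact: measurableD.
    + exact: measurableU.
    move=> x [Nx Ex]; have [Zx|Zx] := pselect (Z1 x); first by left.
    right; split => // Lx; apply: Ex.
    by rewrite -[x](act1 tau_action); exact: EP Lx.
  have muU : (mu (Z1 `|` ((N `\` Z1) `\` L j)) <=
    mu Z1 + mu ((N `\` Z1) `\` L j))%E by exact: measureU2.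
  apply: le_trans muU _.
  by rewrite muZ1 add0e (le_trans muL)// lee_fin ltW.
Qed.

End coupling.

Lemma saturated_preimage (R : realType) (X : pMetricType R)
    (G : topologicalGroupType) (tau : G -> X -> X) (E : set (borel X)) :
  group_action tau -> (forall g x, E x -> E (tau g x)) ->
  orbit_proj tau @^-1` (orbit_proj tau @` E) = E.
Proof.
move=> tau_action Einv; apply/seteqP; split => x /=; last by exists x.
move=> [y Ey] /(congr1 val) /= xy.
have : act_orbit tau x x by exists 1%g => //; exact: (act1 tau_action).
by rewrite -xy => -[g _ <-]; exact: Einv.
Qed.

Theorem theorem2p7 (R : realType) (X : pMetricType R)
    (P : R -> (X -> R) -> X -> R) (G : topologicalGroupType) (len : G -> R)
    (tau : G -> X -> X)
    (P_markov : markov_semigroup P)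
    (len_norm : group_norm len)
    (tau_action : group_action tau)
    (tau_continuous : action_unif_continuous len tau)
    (tau_measurable : action_measurable len tau)
    (P_rAC : rAC P len tau [set: X] (fun=> +oo%E))
    (mu nu : probability (borel X) R)
    (mu_radon : radon mu) (nu_radon : radon nu)
    (mu_invariant : invariant_measure P mu)
    (nu_invariant : invariant_measure P nu) :
  (mutually_singular mu nu <->
     mutually_singular (pushforward mu (orbit_proj tau))
                       (pushforward nu (orbit_proj tau))) /\
  (mu `<< nu <->
     pushforward mu (orbit_proj tau) `<< pushforward nu (orbit_proj tau)).
Proof.
have cover := saturated_null_cover P_markov len_norm tau_action tau_continuous
  tau_measurable P_rAC mu_radon mu_invariant nu_invariant.
split; split.
- move=> [N [mN muN nuN]].
  have mNc : measurable (~` N) by exact: measurableC.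
  have [A mA _|E [mE Einv nuE muE]] := cover (~` N) mNc nuN.
    apply/eqP; rewrite -measure_le0 -muN le_measure ?inE//.
      exact: measurableD.
    by move=> x [_ /contrapT].
  have EE := saturated_preimage tau_action Einv.
  exists (~` (orbit_proj tau @` E)); split.
  + by apply: measurableC; move: mE; rewrite -{1}EE.
  + suff : mu (~` E) = 0%E by rewrite -{1}EE.
    apply/eqP; rewrite -measure_le0.
    have mNE : measurable (~` N `\` E) by exact: measurableD.
    have muU : (mu (N `|` (~` N `\` E)) <= mu N + mu (~` N `\` E))%E.
      exact: measureU2.
    rewrite muN muE adde0 in muU; apply: le_trans muU.
    apply: le_measure; rewrite ?inE.
    * exact: measurableC.
    * exact: measurableU.
    by move=> x Ex; have [Nx|Nx] := pselect (N x); [left|right].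
  + by rewrite setCK; move: nuE; rewrite -{1}EE.
- by move=> [N [mN muN nuN]]; exists (orbit_proj tau @^-1` N).
- move=> munu A nuA B mB BA; apply: munu (mB) (@subset_refl _ _).
  by apply/measure0_null_setP => //; exact: nuA.
- move=> munu; apply/null_content_dominatesP => A mA nuA.
  have [N [mN nuN Nmax]] := maximal_null_set mu nu.
  have [E [mE Einv nuE muE]] := cover N mN nuN Nmax.
  have EE := saturated_preimage tau_action Einv.
  have muE0 : mu E = 0%E.
    rewrite -{1}EE; apply: (munu (orbit_proj tau @` E)) => //.
      move=> B mB BE.
      have : (nu (orbit_proj tau @^-1` B) <= nu E)%E.
        apply: le_measure; rewrite ?inE//.
        by rewrite -EE; exact: preimage_subset.
      by rewrite nuE measure_le0 => /eqP.
    by move: mE; rewrite -{1}EE.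
  have mAN : measurable (A `\` N) by exact: measurableD.
  have mNE : measurable (N `\` E) by exact: measurableD.
  have mU : measurable ((N `\` E) `|` (A `\` N)) by exact: measurableU.
  apply/eqP; rewrite -measure_le0.
  apply: (@le_trans _ _ (mu (E `|` ((N `\` E) `|` (A `\` N))))).
    apply: le_measure; rewrite ?inE//; first exact: measurableU.
    move=> x Ax; have [Ex|Ex] := pselect (E x); first by left.
    by right; have [Nx|Nx] := pselect (N x); [left|right].
  have muU1 : (mu (E `|` ((N `\` E) `|` (A `\` N))) <=
    mu E + mu ((N `\` E) `|` (A `\` N)))%E by exact: measureU2.
  have muU2 : (mu ((N `\` E) `|` (A `\` N)) <=
    mu (N `\` E) + mu (A `\` N))%E by exact: measureU2.
  apply: le_trans muU1 _; rewrite muE0 add0e (le_trans muU2)//.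
  by rewrite muE Nmax// adde0.
Qed.
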